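(* The $S_0$-system $(\Xi,\vec{\circ},\Omega)$ on the quotient space $\Omega$, underlying both the discrete-time system $\bar x(t+1)=\hat A\,\vec{\circ}\,\bar x(t)$ and the continuous-time system $\dot{\bar x}(t)=\hat A\,\vec{\circ}\,\bar x(t)$, is a (properly defined) dynamic $S_0$-system: $\hat A\,\vec{\circ}\,(\hat B\,\vec{\circ}\,\bar x)=(\hat A\circ\hat B)\,\vec{\circ}\,\bar x$ for all $\hat A,\hat B\in\Xi$, $\bar x\in\Omega$; $\Omega$ is a Hausdorff space; and for each $\hat A\in\Xi$ the map $\Omega\to\Omega$, $\bar x\mapsto\hat A\,\vec{\circ}\,\bar x$, is continuous.
   Context: $\mathcal V=\bigcup_{n\ge1}\mathbb R^n$ (disjoint union, column vectors), $\mathcal M=\bigcup_{m\ge1}\bigcup_{n\ge1}\mathcal M_{m\times n}$ (all real matrices). $\mathbf 1_k\in\mathbb R^k$ is the all-ones vector, $J_k:=\frac1k\mathbf 1_{k\times k}$ where $\mathbf 1_{k\times k}$ is the $k\times k$ all-ones matrix, $\otimes$ is the Kronecker product. For $A\in\mathcal M_{m\times n}$, $B\in\mathcal M_{p\times q}$, $t=\mathrm{lcm}(n,p)$: $A\circ B:=(A\otimes J_{t/n})(B\otimes J_{t/p})$. For $x\in\mathbb R^r$, $t=\mathrm{lcm}(n,r)$: $A\,\vec{\circ}\,x:=(A\otimes J_{t/n})(x\otimes\mathbf 1_{t/r})$. $x\leftrightarrow y$ means $x\otimes\mathbf 1_\alpha=y\otimes\mathbf 1_\beta$ for some positive integers $\alpha,\beta$;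 $\bar x$ is the class of $x$ and $\Omega=\mathcal V/\!\leftrightarrow$. $A\approx B$ means $A\otimes J_\alpha=B\otimes J_\beta$ for some positive integers $\alpha,\beta$; $\hat A$ is the class of $A$ and $\Xi=\mathcal M/\!\approx$. Set $\hat A\circ\hat B:=\widehat{A\circ B}$ (a semigroup operation on $\Xi$) and $\hat A\,\vec{\circ}\,\bar x:=\overline{A\,\vec{\circ}\,x}$; these are well defined. The topology of $\Omega$ is that of the metric $d_{\mathcal V}(\bar x,\bar y):=\|x\,\vec{\vdash}\,y\|_{\mathcal V}$, where for $x\in\mathbb R^m,y\in\mathbb R^n$, $t=\mathrm{lcm}(m,n)$: $x\,\vec{\vdash}\,y:=x\otimes\mathbf 1_{t/m}-y\otimes\mathbf 1_{t/n}\in\mathbb R^t$ and $\|z\|_{\mathcal V}:=\frac1{\sqrt s}\|z\|$ for $z\in\mathbb R^s$ ($\|\cdot\|$ Euclidean). An $S_0$-system $(G,\varphi,X)$ consists of a semigroup $G$, a set $X$ and $\varphi:G\times X\to X$ with $\varphi(g_1,\varphi(g_2,x))=\varphi(g_1g_2,x)$; it is a dynamic $S_0$-system if $X$ is a Hausdorff topological space and $\varphi(g,\cdot)$ is continuous for each $g\in G$. *)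

(* Defs.v *)
From HB Require Import structures.
From mathcomp Require Import all_boot all_order all_algebra.
From mathcomp Require Import all_classical all_reals all_analysis.
From mathcomp.real_closed Require Import mxtens.
From mathcomp Require Import ring lra.

Set Implicit Arguments.
Unset Strict Implicit.
Unset Printing Implicit Defensive.
Set SsrOldRewriteGoalsOrder.

Import Order.TTheory GRing.Theory Num.Theory.
Local Open Scope ring_scope.
Local Open Scope quotient_scope.

(* dfvec R is the disjoint union of the R^n, n >= 1, and dfmat R that of the
   m x n matrices, m, n >= 1. The index of R^n is a nat with a positivity proof
   rather than a successor because the dimensions met below are products. *)
Record dfvec (R : realType) := DFVec {
  vdim : nat;
  vdim_gt0 : (0 < vdim)%N;
  vval :> 'cV[R]_vdim }.

Record dfmat (R : realType) := DFMat {
  nrows : nat;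
  ncols : nat;
  nrows_gt0 : (0 < nrows)%N;
  ncols_gt0 : (0 < ncols)%N;
  mval :> 'M[R]_(nrows, ncols) }.

HB.instance Definition _ (R : realType) := gen_eqMixin (dfvec R).
HB.instance Definition _ (R : realType) := gen_choiceMixin (dfvec R).
HB.instance Definition _ (R : realType) := gen_eqMixin (dfmat R).
HB.instance Definition _ (R : realType) := gen_choiceMixin (dfmat R).

Section Lcm.
Variables (n p : nat).
Hypotheses (n_gt0 : (0 < n)%N) (p_gt0 : (0 < p)%N).

Lemma lcm_divl_gt0 : (0 < lcmn n p %/ n)%N.
Proof. by rewrite divn_gt0// dvdn_leq ?dvdn_lcml ?lcmn_gt0 ?n_gt0. Qed.

Lemma lcm_divr_gt0 : (0 < lcmn n p %/ p)%N.
Proof. by rewrite divn_gt0// dvdn_leq ?dvdn_lcmr ?lcmn_gt0 ?n_gt0. Qed.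

End Lcm.

Lemma lcm_divlK n p : (n * (lcmn n p %/ n))%N = lcmn n p.
Proof. by rewrite mulnC divnK// dvdn_lcml. Qed.

Lemma lcm_divrK n p : (p * (lcmn n p %/ p))%N = lcmn n p.
Proof. by rewrite mulnC divnK// dvdn_lcmr. Qed.

Lemma lcm_divE n p : (n * (lcmn n p %/ n))%N = (p * (lcmn n p %/ p))%N.
Proof. by rewrite lcm_divlK lcm_divrK. Qed.

Lemma mulpos m n : (0 < m -> 0 < n -> 0 < m * n)%N.
Proof. by move=> m0 n0; rewrite muln_gt0 m0. Qed.

Section DimensionFree.
Variable R : realType.
Implicit Types (x y z : dfvec R) (A B C : dfmat R).

Definition ones k : 'cV[R]_k := const_mx 1.

Definition Jmx k : 'M[R]_k := k%:R^-1 *: const_mx 1.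

Definition vkron x k (k0 : (0 < k)%N) : dfvec R :=
  @DFVec R (vdim x * k) (mulpos (vdim_gt0 x) k0) (vval x *t ones k).

Definition mkron A k (k0 : (0 < k)%N) : dfmat R :=
  DFMat (mulpos (nrows_gt0 A) k0) (mulpos (ncols_gt0 A) k0)
    (mval A *t Jmx k).

Definition vequiv x y : Prop :=
  exists (a b : nat) (a0 : (0 < a)%N) (b0 : (0 < b)%N),
    vkron x a0 = vkron y b0.

Definition mequiv A B : Prop :=
  exists (a b : nat) (a0 : (0 < a)%N) (b0 : (0 < b)%N),
    mkron A a0 = mkron B b0.

(* Semi-tensor products; the casts identify the two equal inner dimensions
   n * (t / n) = t = p * (t / p), where t = lcm(n, p). *)
Definition mm_stp A B : dfmat R :=
  let n := ncols A in let p := nrows B in let t := lcmn n p in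
  DFMat (mulpos (nrows_gt0 A) (lcm_divl_gt0 (ncols_gt0 A) (nrows_gt0 B)))
        (mulpos (ncols_gt0 B) (lcm_divr_gt0 (ncols_gt0 A) (nrows_gt0 B)))
    (castmx (erefl, lcm_divE n p) (mval A *t Jmx (t %/ n))
       *m (mval B *t Jmx (t %/ p))).

Definition mv_stp A x : dfvec R :=
  let n := ncols A in let r := vdim x in let t := lcmn n r in
  DFVec (mulpos (nrows_gt0 A) (lcm_divl_gt0 (ncols_gt0 A) (vdim_gt0 x)))
    (castmx (erefl, lcm_divE n r) (mval A *t Jmx (t %/ n))
       *m (vval x *t ones (t %/ r) : 'cV_(r * (t %/ r)))).

Lemma lcm_vdim_gt0 x y : (0 < lcmn (vdim x) (vdim y))%N.
Proof. by rewrite lcmn_gt0 !vdim_gt0. Qed.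

Definition vminus x y : dfvec R :=
  let m := vdim x in let n := vdim y in let t := lcmn m n in
  DFVec (lcm_vdim_gt0 x y)
    (castmx (lcm_divlK m n, erefl) (vval x *t ones (t %/ m) : 'cV_(m * (t %/ m)))
   - castmx (lcm_divrK m n, erefl) (vval y *t ones (t %/ n) : 'cV_(n * (t %/ n)))).

Definition vnorm z : R :=
  (Num.sqrt (vdim z)%:R)^-1 * Num.sqrt (\sum_i vval z i 0 ^+ 2).

Definition vdist x y : R := vnorm (vminus x y).

(* Entries indexed by nat (0 outside the range): in these terms the Kronecker
   products become division of the indices, and no cast is needed. *)

Definition vent x (i : nat) : R := oapp (fun o => vval x o 0) 0 (insub i).

Definition ment A (i j : nat) : R :=
  oapp (fun o => oapp (fun q => mval A o q) 0 (insub j)) 0 (insub i).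

Lemma ventE x (i : 'I_(vdim x)) : vent x i = vval x i 0.
Proof. by rewrite /vent valK. Qed.

Lemma mentE A (i : 'I_(nrows A)) (j : 'I_(ncols A)) : ment A i j = mval A i j.
Proof. by rewrite /ment !valK. Qed.

Lemma vent_out x i : (vdim x <= i)%N -> vent x i = 0.
Proof. by move=> h; rewrite /vent insubF// ltnNge h. Qed.

Lemma ment_out A i j : (nrows A <= i)%N || (ncols A <= j)%N -> ment A i j = 0.
Proof.
rewrite /ment; case/orP => h; first by rewrite [insub i]insubF// ltnNge h.
by case: (insub i) => //= o; rewrite insubF// ltnNge h.
Qed.

Lemma dfvec_ext x y : vdim x = vdim y -> vent x =1 vent y -> x = y.
Proof.
move: x y => [n n0 u] [p p0 v] /= e; case: p / e p0 v => p0 v h.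
have -> : u = v.
  apply/matrixP => i j; rewrite ord1.
  have := h i.
  by rewrite (@ventE (DFVec n0 u) i) (@ventE (DFVec p0 v) i).
by rewrite (bool_irrelevance n0 p0).
Qed.

Lemma dfmat_ext A B : nrows A = nrows B -> ncols A = ncols B ->
  ment A =2 ment B -> A = B.
Proof.
move: A B => [m n m0 n0 u] [p q p0 q0 v] /= e f.
case: p / e p0 v => p0 v; case: q / f q0 v => q0 v h.
have -> : u = v.
  apply/matrixP => i j.
  have := h i j.
  by rewrite (@mentE (DFMat m0 n0 u) i j) (@mentE (DFMat p0 q0 v) i j).
by rewrite (bool_irrelevance m0 p0) (bool_irrelevance n0 q0).
Qed.

Definition vres x k i : R := vent x (i %/ k).
Definition mres A k i j : R := ment A (i %/ k) (j %/ k) / k%:R.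

Lemma tens_onesE x k (i : 'I_(vdim x * k)) j :
  (vval x *t ones k) i j = vres x k i.
Proof.
by rewrite !mxE mulr1 /vres -[(_ %/ _)%N]/(val (mxtens_unindex i).1) ventE ord1.
Qed.

Lemma tens_JE A k (i : 'I_(nrows A * k)) (j : 'I_(ncols A * k)) :
  (mval A *t Jmx k) i j = mres A k i j.
Proof.
by rewrite !mxE mulr1 /mres -mentE.
Qed.

Lemma vent_vkron x k (k0 : (0 < k)%N) i : vent (vkron x k0) i = vres x k i.
Proof.
case: (ltnP i (vdim x * k)) => h; last first.
  by rewrite vent_out//= /vres vent_out// leq_divRL.
by rewrite (@ventE (vkron x k0) (Ordinal h)) tens_onesE.
Qed.

Lemma ment_mkron A k (k0 : (0 < k)%N) i j : ment (mkron A k0) i j = mres A k i j.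
Proof.
case: (ltnP i (nrows A * k)) => h; last first.
  by rewrite ment_out /= ?h// /mres ment_out ?mul0r// leq_divRL ?h.
case: (ltnP j (ncols A * k)) => g; last first.
  by rewrite ment_out /= ?g ?orbT// /mres ment_out ?mul0r// !leq_divRL ?g ?orbT.
by rewrite (@mentE (mkron A k0) (Ordinal h) (Ordinal g)) tens_JE.
Qed.

Lemma vequivP x y : vequiv x y <-> exists a b,
  [/\ (0 < a)%N, (0 < b)%N, (vdim x * a = vdim y * b)%N & vres x a =1 vres y b].
Proof.
split=> [[a [b [a0 [b0 e]]]]|[a [b [a0 b0 e h]]]]; exists a, b.
  split=> //; first exact: (congr1 (@vdim R) e).
  by move=> i; rewrite -(vent_vkron x a0) e vent_vkron.
by exists a0, b0; apply: dfvec_ext => // i; rewrite !vent_vkron.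
Qed.

Lemma mequivP A B : mequiv A B <-> exists a b,
  [/\ (0 < a)%N, (0 < b)%N, (nrows A * a = nrows B * b)%N,
   (ncols A * a = ncols B * b)%N & mres A a =2 mres B b].
Proof.
split=> [[a [b [a0 [b0 e]]]]|[a [b [a0 b0 e f h]]]]; exists a, b.
  split=> //; first exact: (congr1 (@nrows R) e).
    exact: (congr1 (@ncols R) e).
  by move=> i j; rewrite -(ment_mkron A a0) e ment_mkron.
by exists a0, b0; apply: dfmat_ext => // i j; rewrite !ment_mkron.
Qed.

Lemma vresM x a c i : vres x (a * c) i = vres x a (i %/ c).
Proof. by rewrite /vres mulnC divnMA. Qed.

Lemma mresM A a c i j : mres A (a * c) i j = mres A a (i %/ c) (j %/ c) / c%:R.
Proof. by rewrite /mres mulnC !divnMA natrM invfM mulrA mulrAC. Qed.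

Lemma vequiv_refl x : vequiv x x.
Proof. by exists 1%N, 1%N, erefl, erefl. Qed.

Lemma vequiv_sym x y : vequiv x y -> vequiv y x.
Proof. by move=> [a [b [a0 [b0 e]]]]; exists b, a, b0, a0. Qed.

Lemma vequiv_trans y x z : vequiv x y -> vequiv y z -> vequiv x z.
Proof.
move=> /vequivP[a [b [a0 b0 e h]]] /vequivP[c [d [c0 d0 f g]]].
apply/vequivP; exists (a * c)%N, (d * b)%N; rewrite !muln_gt0 a0 b0 c0 d0.
split=> // [|i]; first by rewrite !mulnA e mulnAC f.
by rewrite vresM h -vresM mulnC vresM g -vresM.
Qed.

Lemma mequiv_refl A : mequiv A A.
Proof. by exists 1%N, 1%N, erefl, erefl. Qed.

Lemma mequiv_sym A B : mequiv A B -> mequiv B A.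
Proof. by move=> [a [b [a0 [b0 e]]]]; exists b, a, b0, a0. Qed.

Lemma mequiv_trans B A C : mequiv A B -> mequiv B C -> mequiv A C.
Proof.
move=> /mequivP[a [b [a0 b0 e e' h]]] /mequivP[c [d [c0 d0 f f' g]]].
apply/mequivP; exists (a * c)%N, (d * b)%N; rewrite !muln_gt0 a0 b0 c0 d0.
split=> // [||i j]; first by rewrite !mulnA e mulnAC f.
  by rewrite !mulnA e' mulnAC f'.
by rewrite mresM h -mresM mulnC mresM g -mresM.
Qed.

Lemma sum_divn (F : nat -> R) n c : (0 < c)%N ->
  \sum_(l < n * c) F (l %/ c)%N = (\sum_(l < n) F l) * c%:R.
Proof.
move=> c0; elim: n => [|n IHn]; first by rewrite mul0n !big_ord0 mul0r.
rewrite mulSnr big_split_ord IHn big_ord_recr mulrDl/=; congr (_ + _).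
under eq_bigr => i _ do rewrite divnMDl// divn_small// addn0.
by rewrite sumr_const card_ord mulr_natr.
Qed.

(* If n * a = r * b = T, both factors can be blown up to the inner dimension T
   instead of t = lcm(n, r); the product changes by a factor ones (T / t). *)
Lemma common_mult n r a b : (0 < n)%N -> (n * a = r * b)%N -> (0 < a)%N ->
  exists c, [/\ (0 < c)%N, (n * a = lcmn n r * c)%N,
    a = (lcmn n r %/ n * c)%N & b = (lcmn n r %/ r * c)%N].
Proof.
move=> n0 e a0.
have r0 : (0 < r)%N by case: r e => // /eqP; rewrite mul0n muln_eq0; case: n n0; case: a a0.
have /dvdnP[c ec] : (lcmn n r %| n * a)%N.
  by rewrite dvdn_lcm dvdn_mulr//= e dvdn_mulr.
exists c; rewrite ec mulnC; split=> //.
- by case: c ec => // /eqP; rewrite mul0n muln_eq0; case: n n0 {e}; case: a a0.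
- apply/eqP; rewrite -(eqn_pmul2l n0) mulnA lcm_divlK; apply/eqP.
  by rewrite ec mulnC.
- apply/eqP; rewrite -(eqn_pmul2l r0) mulnA lcm_divrK; apply/eqP.
  by rewrite -e ec mulnC.
Qed.

Lemma vent_mv_stp A x i : vent (mv_stp A x) i =
  let n := ncols A in let r := vdim x in let t := lcmn n r in
  \sum_(l < t) mres A (t %/ n) i l * vres x (t %/ r) l.
Proof.
cbv zeta; set n := ncols A; set r := vdim x; set t := lcmn n r.
have a0 : (0 < t %/ n)%N := lcm_divl_gt0 (ncols_gt0 A) (vdim_gt0 x).
case: (ltnP i (nrows A * (t %/ n))) => h; last first.
  rewrite vent_out// big1// => l _.
  by rewrite /mres ment_out ?mul0r// leq_divRL// h.
rewrite (@ventE (mv_stp A x) (Ordinal h)) mxE.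
pose G l := mres A (t %/ n) i l * vres x (t %/ r) l.
have -> : \sum_(l < t) G l = \sum_(l < r * (t %/ r)) G l by rewrite lcm_divrK.
apply: eq_bigr => l _.
by rewrite castmxE tens_onesE tens_JE.
Qed.

Lemma mv_stp_common A x a b : (ncols A * a = vdim x * b)%N -> (0 < a)%N ->
  exists c, [/\ (0 < c)%N, (vdim (mv_stp A x) * c = nrows A * a)%N &
    forall i, vres (mv_stp A x) c i =
      \sum_(l < ncols A * a) mres A a i l * vres x b l].
Proof.
move=> e a0; have [c [c0 et ea eb]] := common_mult (ncols_gt0 A) e a0.
exists c; split=> // [|i]; first by rewrite /= -mulnA -ea.
rewrite {1}/vres vent_mv_stp/= et ea eb.
pose F l := mres A (lcmn (ncols A) (vdim x) %/ ncols A) (i %/ c) l / c%:R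
  * vres x (lcmn (ncols A) (vdim x) %/ vdim x) l.
under [RHS]eq_bigr => l _.
  rewrite mresM vresM -/(F (l %/ c)%N); over.
rewrite sum_divn// mulr_suml; apply: eq_bigr => l _.
by rewrite /F [RHS]mulrAC divfK// pnatr_eq0 -lt0n.
Qed.

Lemma ment_mm_stp A B i j : ment (mm_stp A B) i j =
  let n := ncols A in let p := nrows B in let t := lcmn n p in
  \sum_(l < t) mres A (t %/ n) i l * mres B (t %/ p) l j.
Proof.
cbv zeta; set n := ncols A; set p := nrows B; set t := lcmn n p.
have a0 : (0 < t %/ n)%N := lcm_divl_gt0 (ncols_gt0 A) (nrows_gt0 B).
have b0 : (0 < t %/ p)%N := lcm_divr_gt0 (ncols_gt0 A) (nrows_gt0 B).
case: (ltnP i (nrows A * (t %/ n))) => h; last first.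
  rewrite ment_out /= ?h// big1// => l _.
  by rewrite /mres ment_out ?mul0r// leq_divRL// h.
case: (ltnP j (ncols B * (t %/ p))) => g; last first.
  rewrite ment_out /= ?g ?orbT// big1// => l _.
  by move: g; rewrite -leq_divRL// => g; rewrite mulrC /mres (@ment_out B) ?mul0r// g orbT.
rewrite (@mentE (mm_stp A B) (Ordinal h) (Ordinal g)) mxE.
pose G l := mres A (t %/ n) i l * mres B (t %/ p) l j.
have -> : \sum_(l < t) G l = \sum_(l < p * (t %/ p)) G l by rewrite lcm_divrK.
apply: eq_bigr => l _.
by rewrite castmxE !tens_JE.
Qed.

Lemma mm_stp_common A B a b : (ncols A * a = nrows B * b)%N -> (0 < a)%N ->
  exists c, [/\ (0 < c)%N, (nrows (mm_stp A B) * c = nrows A * a)%N,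
    (ncols (mm_stp A B) * c = ncols B * b)%N &
    forall i j, mres (mm_stp A B) c i j =
      \sum_(l < ncols A * a) mres A a i l * mres B b l j].
Proof.
move=> e a0; have [c [c0 et ea eb]] := common_mult (ncols_gt0 A) e a0.
exists c; split=> // [||i j]; first by rewrite /= -mulnA -ea.
  by rewrite /= -mulnA -eb.
rewrite {1}/mres ment_mm_stp/= et ea eb.
pose F l := mres A (lcmn (ncols A) (nrows B) %/ ncols A) (i %/ c) l / c%:R
  * (mres B (lcmn (ncols A) (nrows B) %/ nrows B) l (j %/ c) / c%:R).
under [RHS]eq_bigr => l _.
  rewrite !mresM -/(F (l %/ c)%N); over.
rewrite sum_divn// !mulr_suml; apply: eq_bigr => l _.
by rewrite /F mulrA [RHS]mulfVK ?pnatr_eq0 -?lt0n// [RHS]mulrAC.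
Qed.

Lemma mv_stp_equiv A A' x x' :
  mequiv A A' -> vequiv x x' -> vequiv (mv_stp A x) (mv_stp A' x').
Proof.
move=> /mequivP[a [a' [a0 a'0 em en h]]] /vequivP[b [b' [b0 b'0 er g]]].
set N := (ncols A * a)%N; set T := (vdim x * b)%N.
have e : (ncols A * (a * T) = vdim x * (b * N))%N.
  by rewrite mulnA -/N mulnA -/T mulnC.
have e' : (ncols A' * (a' * T) = vdim x' * (b' * N))%N.
  by rewrite mulnA -en -/N mulnA -er -/T mulnC.
have T0 : (0 < T)%N by rewrite mulpos// vdim_gt0.
have [c [c0 ec hc]] := mv_stp_common e (mulpos a0 T0).
have [c' [c'0 ec' hc']] := mv_stp_common e' (mulpos a'0 T0).
apply/vequivP; exists c, c'; split=> // [|i].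
  by rewrite ec ec' !mulnA em.
rewrite hc hc' !mulnA -en; apply: eq_bigr => l _.
by rewrite !mresM !vresM h g.
Qed.

Lemma mm_stp_equiv A A' B B' :
  mequiv A A' -> mequiv B B' -> mequiv (mm_stp A B) (mm_stp A' B').
Proof.
move=> /mequivP[a [a' [a0 a'0 em en h]]] /mequivP[b [b' [b0 b'0 er es g]]].
set N := (ncols A * a)%N; set T := (nrows B * b)%N.
have e : (ncols A * (a * T) = nrows B * (b * N))%N.
  by rewrite mulnA -/N mulnA -/T mulnC.
have e' : (ncols A' * (a' * T) = nrows B' * (b' * N))%N.
  by rewrite mulnA -en -/N mulnA -er -/T mulnC.
have T0 : (0 < T)%N by rewrite mulpos// nrows_gt0.
have [c [c0 ec fc hc]] := mm_stp_common e (mulpos a0 T0).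
have [c' [c'0 ec' fc' hc']] := mm_stp_common e' (mulpos a'0 T0).
apply/mequivP; exists c, c'; split=> // [||i j].
- by rewrite ec ec' !mulnA em.
- by rewrite fc fc' !mulnA es.
rewrite hc hc' !mulnA -en; apply: eq_bigr => l _.
by rewrite !mresM h g.
Qed.

Definition msq T (f : nat -> R) : R := Num.sqrt (T%:R^-1 * \sum_(l < T) f l ^+ 2).

Lemma vdistE x y : vdist x y = let t := lcmn (vdim x) (vdim y) in
  msq t (fun l => vres x (t %/ vdim x) l - vres y (t %/ vdim y) l).
Proof.
rewrite /vdist /vnorm /msq /= sqrtrM ?invr_ge0// sqrtrV//; congr (_ * Num.sqrt _).
apply: eq_bigr => l _; congr (_ ^+ 2).
by rewrite !mxE !castmxE !tens_onesE.
Qed.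

Lemma vdist_common x y a b : (vdim x * a = vdim y * b)%N -> (0 < a)%N ->
  vdist x y = msq (vdim x * a) (fun l => vres x a l - vres y b l).
Proof.
move=> e a0; have [c [c0 et ea eb]] := common_mult (vdim_gt0 x) e a0.
rewrite vdistE/= et ea eb /msq; congr Num.sqrt.
set t := lcmn _ _.
under [in RHS]eq_bigr do rewrite !vresM.
rewrite (sum_divn (fun l => (vres x (t %/ vdim x) l - vres y (t %/ vdim y) l) ^+ 2))//.
by rewrite natrM invfM -[RHS]mulrA [X in _ = _ * X]mulrC mulfK // pnatr_eq0 -lt0n.
Qed.

Lemma msqN T f : msq T (fun l => - f l) = msq T f.
Proof. by rewrite /msq; under eq_bigr do rewrite sqrrN. Qed.

Lemma msqD T f g : msq T (fun l => f l + g l) <= msq T f + msq T g.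
Proof.
rewrite /msq !sqrtrM ?invr_ge0// -mulrDr; apply: ler_wpM2l; first exact: sqrtr_ge0.
elim: T => [|T IHT]; first by rewrite !big_ord0 sqrtr0 addr0.
rewrite !big_ord_recr/=; move: IHT.
set u := f T; set v := g T.
set F := \sum_(i < T) f i ^+ 2; set G := \sum_(i < T) g i ^+ 2.
set S := \sum_(i < T) _ => IHT.
have F0 : 0 <= F by apply: sumr_ge0 => i _; exact: sqr_ge0.
have G0 : 0 <= G by apply: sumr_ge0 => i _; exact: sqr_ge0.
have S0 : 0 <= S by apply: sumr_ge0 => i _; exact: sqr_ge0.
have [u2 v2] := (sqr_ge0 u, sqr_ge0 v).
have {}IHT : S <= (Num.sqrt F + Num.sqrt G) ^+ 2.
  by rewrite -[S]sqr_sqrtr// lerXn2r// nnegrE ?addr_ge0 ?sqrtr_ge0.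
set p := Num.sqrt F in IHT *; set q := Num.sqrt G in IHT *.
have pq : p * q + u * v <= Num.sqrt (F + u ^+ 2) * Num.sqrt (G + v ^+ 2).
  rewrite -sqrtrM ?addr_ge0// (le_trans (ler_norm _))// -sqrtr_sqr.
  rewrite ler_sqrt ?mulr_ge0 ?addr_ge0//.
  rewrite -(sqr_sqrtr F0) -(sqr_sqrtr G0) -/p -/q -subr_ge0.
  have -> : (p ^+ 2 + u ^+ 2) * (q ^+ 2 + v ^+ 2) - (p * q + u * v) ^+ 2
    = (p * v - q * u) ^+ 2 by ring.
  exact: sqr_ge0.
rewrite -[leRHS]ger0_norm ?addr_ge0 ?sqrtr_ge0// -sqrtr_sqr ler_sqrt ?sqr_ge0//.
have hP := sqr_sqrtr (addr_ge0 F0 u2); have hQ := sqr_sqrtr (addr_ge0 G0 v2).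
set P := Num.sqrt _ in pq hP *; set Q := Num.sqrt _ in pq hQ *.
have hp : p ^+ 2 = F := sqr_sqrtr F0.
have hq : q ^+ 2 = G := sqr_sqrtr G0.
nra.
Qed.

Lemma vdist_equiv x x' y y' :
  vequiv x x' -> vequiv y y' -> vdist x y = vdist x' y'.
Proof.
move=> /vequivP[a [a' [a0 a'0 e h]]] /vequivP[b [b' [b0 b'0 f g]]].
set M := (vdim x * a)%N; set N := (vdim y * b)%N.
have N0 : (0 < N)%N by rewrite mulpos// vdim_gt0.
have eN : (vdim x * (a * N) = vdim y * (b * M))%N.
  by rewrite mulnA -/M mulnA -/N mulnC.
have eN' : (vdim x' * (a' * N) = vdim y' * (b' * M))%N.
  by rewrite mulnA -e -/M mulnA -f -/N mulnC.
rewrite (vdist_common eN (mulpos a0 N0)) (vdist_common eN' (mulpos a'0 N0)).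
rewrite /msq !mulnA -e; congr (Num.sqrt (_ * _)); apply: eq_bigr => l _.
by rewrite !vresM h g.
Qed.

Lemma vdistxx x : vdist x x = 0.
Proof.
rewrite (@vdist_common x x 1%N 1%N)// /msq big1 ?mulr0 ?sqrtr0// => l _.
by rewrite subrr expr0n.
Qed.

Lemma vdist_sym x y : vdist x y = vdist y x.
Proof.
rewrite (vdist_common (mulnC _ _) (vdim_gt0 y)).
rewrite (vdist_common (mulnC _ _) (vdim_gt0 x)) -msqN mulnC /msq.
by congr (Num.sqrt (_ * _)); apply: eq_bigr => l _; rewrite opprB.
Qed.

Lemma vdist_triangle y x z : vdist x z <= vdist x y + vdist y z.
Proof.
have [[m0 n0] p0] := (vdim_gt0 x, vdim_gt0 y, vdim_gt0 z).
pose a := (vdim y * vdim z)%N; pose b := (vdim x * vdim z)%N.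
pose c := (vdim x * vdim y)%N.
have exy : (vdim x * a = vdim y * b)%N by rewrite mulnCA.
have eyz : (vdim y * b = vdim z * c)%N.
  by rewrite /b /c mulnA mulnC [(vdim y * _)%N]mulnC.
have exz := etrans exy eyz.
rewrite (vdist_common exz (mulpos n0 p0)) (vdist_common exy (mulpos n0 p0)).
rewrite (vdist_common eyz (mulpos m0 p0)) -exy.
apply: le_trans (msqD _ _ _); rewrite le_eqVlt; apply/orP; left; apply/eqP.
by congr (Num.sqrt (_ * _)); apply: eq_bigr => l _; rewrite addrA subrK.
Qed.

Lemma vdist_eq0 x y : vdist x y = 0 -> vequiv x y.
Proof.
rewrite (vdist_common (mulnC _ _) (vdim_gt0 y)) => /eqP.
have T0 : (0 < vdim x * vdim y)%N by rewrite mulpos ?vdim_gt0.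
rewrite /msq sqrtr_eq0 pmulr_rle0 ?invr_gt0 ?ltr0n// => h.
have {h}/eqP/psumr_eq0P-/(_ _)/(_ _ isT) h :
    \sum_(l < vdim x * vdim y) (vres x (vdim y) l - vres y (vdim x) l) ^+ 2 == 0.
  by rewrite eq_le h sumr_ge0// => l _; exact: sqr_ge0.
apply/vequivP; exists (vdim y), (vdim x); rewrite !vdim_gt0 mulnC; split=> // i.
case: (ltnP i (vdim x * vdim y)) => hi; last first.
  by rewrite /vres !vent_out// leq_divRL ?vdim_gt0// mulnC.
apply/eqP; rewrite -subr_eq0 -sqrf_eq0; apply/eqP.
by apply: (h _ (Ordinal hi)) => l _; exact: sqr_ge0.
Qed.

End DimensionFree.

Section Quotients.
Variable R : realType.

Definition vequiv_rel : rel (dfvec R) := [rel x y | `[< vequiv x y >]].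

Definition mequiv_rel : rel (dfmat R) := [rel A B | `[< mequiv A B >]].

Lemma vequiv_is_equiv : equiv_class_of vequiv_rel.
Proof.
split=> [x|x y|y x z] /=; first exact/asboolP/vequiv_refl.
  by apply/asboolP/asboolP; exact: vequiv_sym.
by move=> /asboolP xy /asboolP yz; apply/asboolP; exact: vequiv_trans xy yz.
Qed.

Lemma mequiv_is_equiv : equiv_class_of mequiv_rel.
Proof.
split=> [A|A B|B A C] /=; first exact/asboolP/mequiv_refl.
  by apply/asboolP/asboolP; exact: mequiv_sym.
by move=> /asboolP AB /asboolP BC; apply/asboolP; exact: mequiv_trans AB BC.
Qed.

Canonical vequiv_equiv_rel := EquivRelPack vequiv_is_equiv.
Canonical mequiv_equiv_rel := EquivRelPack mequiv_is_equiv.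

Definition Omega : Type := {eq_quot vequiv_rel}.
Definition Xi : Type := {eq_quot mequiv_rel}.

HB.instance Definition _ := Choice.on Omega.
HB.instance Definition _ := EqQuotient.on Omega.
HB.instance Definition _ := Choice.on Xi.
HB.instance Definition _ := EqQuotient.on Xi.

Definition vclass (x : dfvec R) : Omega := \pi_Omega x.
Definition mclass (A : dfmat R) : Xi := \pi_Xi A.

Lemma vclassP x y : vclass x = vclass y <-> vequiv x y.
Proof. by split=> [/eqquotP/asboolP|h]//; apply/eqquotP/asboolP. Qed.

Lemma mclassP A B : mclass A = mclass B <-> mequiv A B.
Proof. by split=> [/eqquotP/asboolP|h]//; apply/eqquotP/asboolP. Qed.

Lemma vclass_repr (X : Omega) : vclass (repr X) = X.
Proof. exact: reprK. Qed.

Lemma mclass_repr (X : Xi) : mclass (repr X) = X.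
Proof. exact: reprK. Qed.

(* These operations are defined on chosen representatives; the lemmas
   Xi_mulE, Xi_actE and Omega_distE state that the choice is irrelevant. *)
Definition Xi_mul (X Y : Xi) : Xi := mclass (mm_stp (repr X) (repr Y)).

Definition Xi_act (X : Xi) (x : Omega) : Omega := vclass (mv_stp (repr X) (repr x)).

Definition Omega_dist (x y : Omega) : R := vdist (repr x) (repr y).

Lemma Xi_mulE A B : Xi_mul (mclass A) (mclass B) = mclass (mm_stp A B).
Proof. by apply/mclassP/mm_stp_equiv; apply/mclassP; rewrite mclass_repr. Qed.

Lemma Xi_actE A x : Xi_act (mclass A) (vclass x) = vclass (mv_stp A x).
Proof.
apply/vclassP/mv_stp_equiv; first by apply/mclassP; rewrite mclass_repr.
by apply/vclassP; rewrite vclass_repr.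
Qed.

Lemma Omega_distE x y : Omega_dist (vclass x) (vclass y) = vdist x y.
Proof. by apply: vdist_equiv; apply/vclassP; rewrite vclass_repr. Qed.

Lemma Omega_dist_eq0 x y : Omega_dist x y = 0 -> x = y.
Proof. by move/vdist_eq0/vclassP; rewrite !vclass_repr. Qed.

HB.instance Definition _ := isMetric.Build R Omega
  (fun x => vdistxx (repr x)) Omega_dist_eq0
  (fun x y => vdist_sym (repr x) (repr y))
  (fun y x z => vdist_triangle (repr y) (repr x) (repr z)).

End Quotients.

Definition S0_system (G X : Type) (op : G -> G -> G) (phi : G -> X -> X) : Prop :=
  associative op /\
  forall g1 g2 x, phi g1 (phi g2 x) = phi (op g1 g2) x.

Definition dynamic_S0_system (G : Type) (X : topologicalType)
    (op : G -> G -> G) (phi : G -> X -> X) : Prop :=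
  [/\ S0_system op phi, hausdorff_space X & forall g, continuous (phi g)].

(* Main.v *)
Require Import Defs.
From HB Require Import structures.
From mathcomp Require Import all_boot all_order all_algebra.
From mathcomp Require Import all_classical all_reals all_analysis.
From mathcomp Require Import ring.

Set Implicit Arguments.
Unset Strict Implicit.
Unset Printing Implicit Defensive.
Set SsrOldRewriteGoalsOrder.

Import Order.TTheory GRing.Theory Num.Theory.
Local Open Scope ring_scope.

(** Up to equivalence, semi-tensor products may be computed at any common
    multiple of the inner dimensions, where they become ordinary matrix
    products; this gives associativity. By Cauchy-Schwarz the action of [A] is
    Lipschitz in each dimension, and the normalisations of [Jmx] and [vnorm]
    make the constant the same for all dimensions of the vectors. *)

Section SumOfSquares.
Variable R : realType.

Lemma sumr_sqr_ge0 n (f : nat -> R) : 0 <= \sum_(l < n) f l ^+ 2.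
Proof. by apply: sumr_ge0 => l _; exact: sqr_ge0. Qed.

(** With [F], [G] the sums of squares and [S] the mixed sum, expanding the sum of squares of
    [G * f l - S * g l] gives [G * (F * G - S ^+ 2)], from which a positive [G] can be cancelled. If
    [G] is zero, so is every [g l], and both sides vanish. *)
Lemma sum_CauchySchwarz n (f g : nat -> R) :
  (\sum_(l < n) f l * g l) ^+ 2
    <= (\sum_(l < n) f l ^+ 2) * (\sum_(l < n) g l ^+ 2).
Proof.
set S := \sum_(l < n) f l * g l; set F := \sum_(l < n) f l ^+ 2.
set G := \sum_(l < n) g l ^+ 2.
have G0 : 0 <= G := sumr_sqr_ge0 n g.
have [G_eq0|G_neq0] := eqVneq G 0.
  have g0 (l : 'I_n) : g l = 0.
    apply/eqP; rewrite -sqrf_eq0; apply/eqP.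
    by apply: (psumr_eq0P _ G_eq0) => // i _; exact: sqr_ge0.
  by rewrite G_eq0 mulr0 /S big1 ?expr0n// => l _; rewrite g0 mulr0.
have : 0 <= \sum_(l < n) (G * f l - S * g l) ^+ 2 :=
  sumr_sqr_ge0 n (fun l => G * f l - S * g l).
have -> : \sum_(l < n) (G * f l - S * g l) ^+ 2 = G * (F * G - S ^+ 2).
  transitivity (G ^+ 2 * F - (2 * G * S) * S + S ^+ 2 * G); last by ring.
  rewrite [G ^+ 2 * F]mulr_sumr [_ * S]mulr_sumr [S ^+ 2 * G]mulr_sumr.
  by rewrite -sumrB -big_split/=; apply: eq_bigr => l _; ring.
by rewrite pmulr_rge0 ?subr_ge0// lt_neqAle eq_sym G_neq0.
Qed.

(** Cauchy-Schwarz in each row bounds the operator by its Frobenius norm. The ratio [U / T] appears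
    because [msq] averages over [T] entries on the left and over [U] on the right. *)
Lemma msq_mulmx T U (P : nat -> nat -> R) (f : nat -> R) :
  (0 < T)%N -> (0 < U)%N ->
  msq T (fun i => \sum_(l < U) P i l * f l)
    <= Num.sqrt (U%:R / T%:R * \sum_(i < T) \sum_(l < U) P i l ^+ 2) * msq U f.
Proof.
move=> T0 U0; rewrite /msq.
set F := \sum_(i < T) \sum_(l < U) _; set S := \sum_(l < U) f l ^+ 2.
have F0 : 0 <= F by apply: sumr_ge0 => i _; exact: sumr_sqr_ge0.
have S0 : 0 <= S := sumr_sqr_ge0 U f.
rewrite -sqrtrM ?mulr_ge0 ?invr_ge0// ler_wsqrtr//.
have -> : U%:R / T%:R * F * (U%:R^-1 * S) = T%:R^-1 * (F * S).
  by field; rewrite !pnatr_eq0 -!lt0n T0.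
rewrite ler_wpM2l ?invr_ge0// mulr_suml; apply: ler_sum => i _.
exact: sum_CauchySchwarz.
Qed.

End SumOfSquares.

Section SemiTensorProduct.
Variable R : realType.
Implicit Types (x y : dfvec R) (A B C : dfmat R).

Lemma mv_stpA A B x :
  vequiv (mv_stp A (mv_stp B x)) (mv_stp (mm_stp A B) x).
Proof.
(* Blowing up [A], [B], [x] by [a], [b], [d] makes both inner dimensions match at once, with the
   same copy of [B] in both bracketings. *)
set a := (nrows B * vdim x)%N; set b := (ncols A * vdim x)%N.
set d := (ncols A * ncols B)%N.
have e : (ncols A * a = nrows B * b)%N by rewrite mulnCA.
have f : (ncols B * b = vdim x * d)%N by rewrite mulnCA mulnA [RHS]mulnC.
have a0 : (0 < a)%N by rewrite mulpos ?nrows_gt0 ?vdim_gt0.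
have b0 : (0 < b)%N by rewrite mulpos ?ncols_gt0 ?vdim_gt0.
have [c [_ ec hc]] := mv_stp_common f b0.
have [c' [c'0 ec' hc']] := mv_stp_common (etrans e (esym ec)) a0.
have [k [k0 ek fk hk]] := mm_stp_common e a0.
have [k' [k'0 ek' hk']] := mv_stp_common (etrans fk f) k0.
apply/vequivP; exists c', k'; split=> // [|i]; first by rewrite ec' ek' ek.
rewrite hc' hk' fk.
(* Both sides are now the same double sum, up to the order of summation. *)
under eq_bigr do rewrite hc mulr_sumr.
under [RHS]eq_bigr do rewrite hk mulr_suml.
by rewrite exchange_big/=; do 2!apply: eq_bigr => ? _; rewrite mulrA.
Qed.

(** The argument of [mv_stpA], with [nrows C] in the place of [vdim x]. *)
Lemma mm_stpA A B C :
  mequiv (mm_stp A (mm_stp B C)) (mm_stp (mm_stp A B) C).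
Proof.
set a := (nrows B * nrows C)%N; set b := (ncols A * nrows C)%N.
set d := (ncols A * ncols B)%N.
have e : (ncols A * a = nrows B * b)%N by rewrite mulnCA.
have f : (ncols B * b = nrows C * d)%N by rewrite mulnCA mulnA [RHS]mulnC.
have a0 : (0 < a)%N by rewrite mulpos ?nrows_gt0.
have b0 : (0 < b)%N by rewrite mulpos ?ncols_gt0 ?nrows_gt0.
have [c [_ ec fc hc]] := mm_stp_common f b0.
have [c' [c'0 ec' fc' hc']] := mm_stp_common (etrans e (esym ec)) a0.
have [k [k0 ek fk hk]] := mm_stp_common e a0.
have [k' [k'0 ek' fk' hk']] := mm_stp_common (etrans fk f) k0.
apply/mequivP; exists c', k'; split=> // [||i j].
- by rewrite ec' ek' ek.
- by rewrite fc' fk' fc.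
rewrite hc' hk' fk.
under eq_bigr do rewrite hc mulr_sumr.
under [RHS]eq_bigr do rewrite hk mulr_suml.
by rewrite exchange_big/=; do 2!apply: eq_bigr => ? _; rewrite mulrA.
Qed.

(** Each entry of [A] turns into [a ^ 2] entries, each divided by [a], so the Frobenius norm is
    invariant under blowing up. *)
Lemma sum_sqr_mres A a : (0 < a)%N ->
  \sum_(i < nrows A * a) \sum_(j < ncols A * a) mres A a i j ^+ 2
    = \sum_(i < nrows A) \sum_(j < ncols A) ment A i j ^+ 2.
Proof.
move=> a0.
have an0 : a%:R != 0 :> R by rewrite pnatr_eq0 -lt0n.
pose F i := \sum_(j < ncols A) ment A i j ^+ 2.
(* Summing over columns repeats each term [a] times, which leaves one factor [1 / a] for the rows to
   absorb. *)
transitivity (\sum_(i < nrows A * a) F (i %/ a)%N / a%:R).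
  apply: eq_bigr => i _.
  rewrite (@sum_divn _ (fun j => (ment A (i %/ a) j / a%:R) ^+ 2))//.
  rewrite !mulr_suml; apply: eq_bigr => j _.
  by field.
by rewrite -mulr_suml sum_divn// mulfK.
Qed.

Lemma mv_stp_lipschitz A : exists K, forall x y,
  vdist (mv_stp A x) (mv_stp A y) <= K * vdist x y.
Proof.
exists (Num.sqrt ((ncols A)%:R / (nrows A)%:R *
  \sum_(i < nrows A) \sum_(j < ncols A) ment A i j ^+ 2)) => x y.
(* A single blow-up of [A] fits both [x] and [y], so the difference of the two products is one
   matrix applied to the difference [g] of the vectors. *)
set a := (vdim x * vdim y)%N; set b := (ncols A * vdim y)%N.
set c := (ncols A * vdim x)%N.
have e : (ncols A * a = vdim x * b)%N by rewrite mulnCA.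
have f : (ncols A * a = vdim y * c)%N.
  by rewrite /a [(vdim x * _)%N]mulnC mulnCA.
have a0 : (0 < a)%N by rewrite mulpos ?vdim_gt0.
have b0 : (0 < b)%N by rewrite mulpos ?vdim_gt0 ?ncols_gt0.
have [k [k0 ek hk]] := mv_stp_common e a0.
have [k' [_ ek' hk']] := mv_stp_common f a0.
rewrite (vdist_common (etrans ek (esym ek')) k0) ek.
rewrite (vdist_common (etrans (esym e) f) b0) -e.
pose g l := vres x b l - vres y c l.
have -> : (fun i => vres (mv_stp A x) k i - vres (mv_stp A y) k' i) =
    (fun i => \sum_(l < ncols A * a) mres A a i l * g l).
  apply/funext => i; rewrite hk hk' -sumrB.
  by apply: eq_bigr => l _; rewrite mulrBr.
have := @msq_mulmx R (nrows A * a) (ncols A * a) (mres A a) g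
  (mulpos (nrows_gt0 A) a0) (mulpos (ncols_gt0 A) a0).
(* The factor [a], the only trace of [x] and [y] in the constant, cancels between columns and
   rows. *)
by rewrite sum_sqr_mres// !(natrM _ _ a) -mulf_div divff ?mulr1//
  pnatr_eq0 -lt0n.
Qed.

End SemiTensorProduct.

Section Quotients.
Variable R : realType.
Implicit Types (X Y Z : Xi R) (x : Omega R).

Lemma Xi_mulA : associative (@Xi_mul R).
Proof.
move=> X Y Z; rewrite -[X]mclass_repr -[Y]mclass_repr -[Z]mclass_repr.
by rewrite !Xi_mulE; apply/mclassP/mm_stpA.
Qed.

Lemma Xi_actA X Y x : Xi_act X (Xi_act Y x) = Xi_act (Xi_mul X Y) x.
Proof.
rewrite -[X]mclass_repr -[Y]mclass_repr -[x]vclass_repr.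
by rewrite Xi_mulE !Xi_actE; apply/vclassP/mv_stpA.
Qed.

Lemma Xi_act_lipschitz X : exists K, forall x y : Omega R,
  Omega_dist (Xi_act X x) (Xi_act X y) <= K * Omega_dist x y.
Proof.
have [K hK] := mv_stp_lipschitz (repr X).
by exists K => x y; rewrite /Xi_act Omega_distE; exact: hK.
Qed.

Lemma Xi_act_continuous X : continuous (Xi_act X : Omega R -> Omega R).
Proof.
have [K hK] := Xi_act_lipschitz X => x.
apply/(@metricType_numDomainType.cvgrPdist_lt _ _ _ _ (nbhs_filter x)) => e e0.
apply/metricType_numDomainType.nbhs_mdistP.
(* The sign of [K] is unknown and [K] may be zero, hence a positive upper bound of it to divide
   by. *)
have K0 : 0 < `|K| + 1 by rewrite ltr_wpDl.
exists (e / (`|K| + 1)); first by rewrite /= divr_gt0.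
move=> y /= xy; apply: (le_lt_trans (hK x y)).
have xy0 : 0 <= mdist x y := mdist_ge0 x y.
rewrite ltr_pdivlMr// mulrC in xy; apply: le_lt_trans xy.
by apply: ler_wpM2r => //; rewrite (le_trans (ler_norm K))// lerDl.
Qed.

End Quotients.

Theorem mainTheorem8 (R : realType) :
  @dynamic_S0_system (Xi R) (Omega R) (@Xi_mul R) (@Xi_act R).
Proof.
split; last exact: Xi_act_continuous.
  by split; [exact: Xi_mulA | exact: Xi_actA].
exact: metric_hausdorff.
Qed.
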